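(* Let $a, b \ge 2$ be integers. Let $d$ be the smallest positive divisor of $a$ such that $\gcd(a/d, b) = 1$, and suppose that $\log(d)/\log(b)$ is irrational. Then there exists $C > 0$, depending only on $a$ and $b$, such that $c_b(a^n) > C \log n$ for all sufficiently large integers $n$.
   Context: For an integer $b \ge 2$ and a nonnegative integer $N$, $c_b(N)$ denotes the number of nonzero digits in the base-$b$ expansion of $N$. $\log$ denotes the natural logarithm. *)

(* Defs.v *)
From mathcomp Require Import all_boot.

Set Implicit Arguments.
Unset Strict Implicit.
Unset Printing Implicit Defensive.

Local Open Scope nat_scope.

Definition digit (b N i : nat) : nat := (N %/ b ^ i) %% b.

(* Positions i >= N are omitted from the count: for 1 < b we have N < b ^ N, so
   the digits there vanish (digit_geq), and the positions i < N already carry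
   the whole expansion (digit_expansion). *)
Definition nonzero_digits (b N : nat) : nat :=
  #|[set i : 'I_N | digit b N i != 0]|.

Lemma ltn_digit (b N i : nat) : 1 < b -> digit b N i < b.
Proof. by move=> b1; rewrite ltn_mod ltnW. Qed.

Lemma digit_geq (b N i : nat) : 1 < b -> N <= i -> digit b N i = 0.
Proof.
move=> b1 Ni; rewrite /digit divn_small ?mod0n//.
by rewrite (leq_ltn_trans Ni)// ltn_expl.
Qed.

Lemma digit_expansion (b N : nat) :
  1 < b -> N = \sum_(i < N) digit b N i * b ^ i.
Proof.
move=> b1; have b0 : 0 < b by exact: ltnW.
have modE k : N %% b ^ k = \sum_(i < k) digit b N i * b ^ i.
  elim: k => [|k IH]; first by rewrite big_ord0 expn0 modn1.
  rewrite big_ord_recr /= -IH /digit.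
  rewrite {1}(divn_eq N (b ^ k)) {1}(divn_eq (N %/ b ^ k) b).
  rewrite mulnDl -mulnA -expnS -addnA modnMDl modn_small 1?addnC//.
  rewrite expnS; apply: (@leq_trans (((N %/ b ^ k) %% b).+1 * b ^ k)).
    by rewrite mulSn ltn_add2r ltn_mod expn_gt0 b0.
  by rewrite leq_mul2r ltn_mod b0 orbT.
by rewrite -modE modn_small// ltn_expl.
Qed.

Definition least_divisor_coprime_quotient (a b d : nat) : Prop :=
  [/\ 0 < d, d %| a, coprime (a %/ d) b &
      forall e : nat, 0 < e -> e %| a -> coprime (a %/ e) b -> d <= e].

(* Main.v *)
(* d is the part of a made of the primes dividing b, so irrationality of
   log d / log b says that the ratio of p-adic valuations
   v_p(a) / v_p(b) is not the same for all primes p | b.  Let q minimise it, let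
   p have a larger ratio, and write a^n = b^s * M with s maximal.  Then b does
   not divide M, while p^K divides M with K of order n.  For k <= K the residue
   of M mod b^k is therefore a nonzero multiple of p^k, hence at least p^k.
   Taking k = b^(i+1), so that p^k >= b^(b^i), we see that M has a nonzero digit
   at a position in [b^i, b^(i+1)), for every i with b^(i+1) <= K. *)

Require Import Defs.
From mathcomp Require Import all_boot all_order all_algebra.
From mathcomp Require Import all_classical all_reals all_analysis.
From mathcomp Require Import zify.

Set Implicit Arguments.
Unset Strict Implicit.
Unset Printing Implicit Defensive.

Import Order.TTheory GRing.Theory Num.Theory.

Local Open Scope nat_scope.

Lemma modn_expS_digit b N k :
  N %% b ^ k.+1 = digit b N k * b ^ k + N %% b ^ k.
Proof.
rewrite /digit modn_divl -expnS [LHS](divn_eq _ (b ^ k)); congr (_ + _).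
by rewrite modn_dvdm// expnS dvdn_mull.
Qed.

Lemma modn_exp_digit0 b N m k : m <= k ->
  (forall i, m <= i < k -> digit b N i = 0) -> N %% b ^ k = N %% b ^ m.
Proof.
elim: k => [|k IH]; first by rewrite leqn0 => /eqP ->.
rewrite leq_eqVlt => /orP[/eqP -> //|]; rewrite ltnS => mk dig0.
rewrite modn_expS_digit dig0 ?mk ?ltnSn// mul0n add0n IH// => i /andP[mi ik].
by rewrite dig0// mi ltnW.
Qed.

Lemma digit_expM b M s i : 0 < b -> digit b (b ^ s * M) (s + i) = digit b M i.
Proof. by move=> b0; rewrite /digit expnD divnMl// expn_gt0 b0. Qed.

Lemma leq_nonzero_digits b N r (pos : 'I_r -> nat) : 1 < b ->
  injective pos -> (forall i, digit b N (pos i) != 0) ->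
  r <= nonzero_digits b N.
Proof.
move=> b1 pos_inj dig_neq0.
have posN i : pos i < N.
  by rewrite ltnNge; apply: contra (dig_neq0 i) => Npos; rewrite digit_geq.
pose f i := Ordinal (posN i).
have f_inj : injective f by move=> i j /(congr1 val)/pos_inj.
rewrite -[leqLHS]card_ord -(card_imset _ f_inj) /nonzero_digits.
by apply/subset_leq_card/fintype.subsetP => _ /imsetP[i _ ->]; rewrite inE /=.
Qed.

Lemma exists_nonzero_digit b M p K m : 1 < p -> p %| b -> 0 < b ->
  ~~ (b %| M) -> p ^ K %| M -> 0 < m -> b * m <= K ->
  exists2 i, m <= i < b * m & digit b M i != 0.
Proof.
move=> p1 pb b0 bM pM m0 bmK.
have [/existsP[i /andP[mi dig]]|] :=
  boolP [exists i : 'I_(b * m), (m <= i) && (digit b M i != 0)].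
  by exists (val i); rewrite ?mi ?ltn_ord.
rewrite negb_exists => /forallP no_dig.
have modE : M %% b ^ (b * m) = M %% b ^ m.
  apply: modn_exp_digit0 => [|i /andP[mi ibm]]; first exact: leq_pmull.
  by apply/eqP; have /= := no_dig (Ordinal ibm); rewrite mi /= negbK.
(* The window ends at [b * m] because [b < p ^ b], so [p ^ (b * m)] exceeds [b ^ m]. *)
have mod_lt : M %% b ^ m < p ^ (b * m).
  rewrite (@leq_trans (b ^ m)) ?ltn_mod ?expn_gt0 ?b0//.
  by rewrite expnM leq_exp2r// ltnW// ltn_expl.
have mod_gt0 : 0 < M %% b ^ (b * m).
  rewrite lt0n; apply: contra bM => dvd_M; apply: dvdn_trans dvd_M.
  by rewrite -{1}(expn1 b) dvdn_exp2l// muln_gt0 b0.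
have dvd_mod : p ^ (b * m) %| M %% b ^ (b * m).
  rewrite /dvdn modn_dvdm ?dvdn_exp2r// -/(dvdn _ _).
  exact: dvdn_trans (dvdn_exp2l p bmK) pM.
by have := dvdn_leq mod_gt0 dvd_mod; rewrite modE leqNgt mod_lt.
Qed.

Lemma trunc_log_leq_nonzero_digits b M p K s : 1 < p -> p %| b -> 1 < b ->
  ~~ (b %| M) -> p ^ K %| M -> trunc_log b K <= nonzero_digits b (b ^ s * M).
Proof.
move=> p1 pb b1 bM pM; have b0 := ltnW b1; set r := trunc_log b K.
have ex (i : 'I_r) : exists j, b ^ i <= j < b ^ i.+1 /\ digit b M j != 0.
  have biK : b * b ^ i <= K.
    have K0 : 0 < K.
      rewrite lt0n; apply/eqP => K0.
      (* [trunc_log b 0] is 0, so for [K = 0] there is no index [i]. *)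
      by case: i => i; rewrite /r K0 trunc_log0.
    by rewrite -expnS (leq_trans _ (trunc_logP b1 K0))// leq_exp2l.
  have bi0 : 0 < b ^ i by rewrite expn_gt0 b0.
  have [j jb dj] := exists_nonzero_digit p1 pb b0 bM pM bi0 biK.
  by exists j; rewrite expnS.
have [pos posP] := fin_all_exists ex.
apply: (@leq_nonzero_digits _ _ _ (fun i => s + pos i)) => // [i j|i].
  move=> /addnI posE; apply: val_inj => /=.
  (* The windows are disjoint: [trunc_log b] recovers the index [i] from any position in
     [[b^i, b^(i+1))]. *)
  have [[/(trunc_log_eq b1) <- _] [/(trunc_log_eq b1) <- _]] :=
    (posP i, posP j).
  by rewrite posE.
by rewrite digit_expM//; case: (posP i).
Qed.

(** The ratios [f x / g x] are compared by cross multiplication, which stays within [nat]. *)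
Lemma exists_min_ratio (T : eqType) (s : seq T) (f g : T -> nat) :
  s != [::] -> {in s, forall x, 0 < g x} ->
  exists2 x, x \in s & {in s, forall y, f x * g y <= f y * g x}.
Proof.
elim: s => // x [|x' s] IH _ g_gt0.
  by exists x; rewrite ?mem_head// => y; rewrite inE => /eqP ->.
have [|y ys ymin] := IH isT; first by move=> z zs; rewrite g_gt0// inE zs orbT.
have [yx|xy] := leqP (f y * g x) (f x * g y).
  exists y; first by rewrite inE ys orbT.
  by move=> z; rewrite inE => /predU1P[->//|/ymin].
exists x; first exact: mem_head.
move=> z; rewrite inE => /predU1P[->//|zs].
have gy0 : 0 < g y by rewrite g_gt0// inE ys orbT.
rewrite -(leq_pmul2l gy0) mulnCA.
rewrite (@leq_trans (g x * (f y * g z)))//; first by nia.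
by have := ymin _ zs; nia.
Qed.

(** Otherwise [d / p] would be a smaller divisor whose cofactor is still coprime to [b]. *)
Lemma least_divisor_prime_dvdn a b d p : 0 < a ->
  least_divisor_coprime_quotient a b d -> prime p -> p %| d -> p %| b.
Proof.
move=> a0 [d0 /dvdnP[c ac] cop dmin] pp /dvdnP[e de]; apply/negPn/negP => pb.
have p0 := prime_gt0 pp.
have e0 : 0 < e by move: d0; rewrite de muln_gt0 => /andP[].
have ae : a = c * p * e by rewrite ac de -mulnA (mulnC e).
have : d <= e.
  apply: dmin => //; first by rewrite ae dvdn_mull.
  rewrite ae mulnK// coprimeMl [coprime p b]prime_coprime// pb andbT.
  by move: cop; rewrite ac mulnK.
by rewrite de -{2}(muln1 e) leq_pmul2l// leqNgt prime_gt1.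
Qed.

Lemma least_divisor_logn a b d p : 0 < a ->
  least_divisor_coprime_quotient a b d -> p \in primes b ->
  logn p d = logn p a.
Proof.
move=> a0 [d0 da cop _]; rewrite mem_primes => /and3P[pp b0 pb].
have ad0 : 0 < a %/ d by rewrite divn_gt0// dvdn_leq.
rewrite -[a in RHS](divnK da) lognM// [logn p (a %/ d)]logn_coprime//.
by rewrite coprime_sym; apply: coprime_dvdr cop.
Qed.

(** If every ratio equalled the minimal one, [d ^ logn q b] and [b ^ logn q d] would have the same
    valuation at each prime; away from [b] both valuations vanish. *)
Lemma exists_ratio_gt (b d q : nat) : 0 < d -> 0 < b ->
  (forall p, prime p -> p %| d -> p %| b) ->
  d ^ logn q b <> b ^ logn q d ->
  {in primes b, forall p, logn q d * logn p b <= logn p d * logn q b} ->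
  exists2 p, p \in primes b & logn q d * logn p b < logn p d * logn q b.
Proof.
move=> d0 b0 db neq qmin; apply/hasP; apply/negPn/negP => /hasPn no.
apply: neq; apply: eqn_from_log; rewrite ?expn_gt0 ?d0 ?b0// => p.
rewrite !lognX; have [pb|pNb] := boolP (p \in primes b).
  rewrite mulnC; apply/eqP; rewrite eqn_leq qmin// andbT leqNgt.
  exact: no.
have logb : logn p b = 0.
  by apply/eqP; rewrite -leqn0 leqNgt logn_gt0.
have logd : logn p d = 0.
  apply/eqP; rewrite -leqn0 leqNgt logn_gt0; apply: contra pNb.
  by rewrite !mem_primes => /and3P[pp _ pd]; rewrite pp b0 db.
by rewrite logb logd !muln0.
Qed.

Lemma ltn_exp_nonzero_digits a b p q n : 0 < a -> 1 < b ->
  p \in primes b -> q \in primes b ->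
  {in primes b, forall r, logn q a * logn r b <= logn r a * logn q b} ->
  logn q a * logn p b < logn p a * logn q b ->
  n < b ^ (nonzero_digits b (a ^ n)).+2.
Proof.
move=> a0 b1 pb qb qmin pq; have b0 := ltnW b1.
have := pb; rewrite mem_primes => /and3P[pp _ pdvd].
set y := logn q b in qmin pq *; have y0 : 0 < y by rewrite logn_gt0.
(* By minimality of the ratio at [q], this is the largest [s] with [b ^ s] dividing [a ^ n]. *)
set s := (logn q a * n) %/ y.
have s_le : s * y <= logn q a * n by exact: leq_divM.
have s_gt : logn q a * n < s.+1 * y by exact: ltn_ceil.
have an0 : 0 < a ^ n by rewrite expn_gt0 a0.
have dvd_an : b ^ s %| a ^ n.
  apply/dvdn_partP => [|r]; first by rewrite expn_gt0 b0.
  have [->|s0] := posnP s; first by rewrite expn0.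
  rewrite pi_of_exp// => rb; rewrite p_part pfactor_dvdn//; last first.
    by move: rb; rewrite mem_primes => /andP[].
  rewrite !lognX -(leq_pmul2r y0).
  by have := qmin _ rb; nia.
have /dvdnP[M anE] := dvd_an.
have M0 : 0 < M by move: an0; rewrite anE muln_gt0 => /andP[].
have logM r : n * logn r a = logn r M + s * logn r b.
  by rewrite -!lognX anE lognM ?lognX// expn_gt0 b0.
(* [logn q M] is the remainder of the division defining [s], hence less than [y]. *)
have bM : ~~ (b %| M).
  apply/negP => /(dvdn_leq_log q M0); rewrite -/y => yM.
  by have := logM q; rewrite -/y => qM; nia.
(* The strict inequality [pq] between integers has a gap of at least 1; multiplied by [n], it gives
   [n <= logn p M * y]. *)
have pM : p ^ (n %/ y) %| M.
  rewrite pfactor_dvdn// -(leq_pmul2r y0) (leq_trans (leq_divM _ _))//.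
  have := logM p; nia.
have := trunc_log_leq_nonzero_digits s (prime_gt1 pp) pdvd b1 bM pM.
rewrite anE mulnC => digits_ge.
(* In [n < (n %/ y).+1 * y], the factor [y] is at most [b] and the other at most [b ^ c.+1], where
   [c] is the digit count. *)
rewrite (leq_trans (ltn_ceil n y0))// expnS mulnC.
rewrite leq_mul//; first by rewrite ltnW// ltn_logl.
by rewrite (leq_trans (trunc_log_ltn _ b1))// leq_exp2l// ltnS.
Qed.

Local Close Scope nat_scope.
Local Open Scope classical_set_scope.
Local Open Scope ring_scope.

Lemma ln_ratio_rational (R : realType) (d b u v : nat) :
  (0 < d)%N -> (1 < b)%N -> (0 < v)%N -> (d ^ v = b ^ u)%N ->
  rational (ln (d%:R : R) / ln (b%:R : R)).
Proof.
move=> d0 b1 v0 dvbu; apply/rationalP; exists u%:Z, v.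
have lnb : ln (b%:R : R) != 0 by rewrite gt_eqF// ln_gt0// ltr1n.
have v_neq0 : v%:R != 0 :> R by rewrite pnatr_eq0 -lt0n.
apply/eqP; rewrite eqr_div// mulr_natr mulrC mulr_natr.
rewrite -!lnXn ?ltr0n// ?(ltnW b1)//.
by rewrite -!natrX dvbu.
Qed.

Theorem theorem4p4 (R : realType) (a b d : nat)
    (a_ge2 : (2 <= a)%N) (b_ge2 : (2 <= b)%N)
    (d_least : least_divisor_coprime_quotient a b d)
    (log_irrational : irrational (ln (d%:R : R) / ln (b%:R : R))) :
  exists C : R, 0 < C /\
    \forall n \near \oo, C * ln (n%:R : R) < (nonzero_digits b (a ^ n)%N)%:R.
Proof.
have a0 : (0 < a)%N := ltnW a_ge2.
have b0 : (0 < b)%N := ltnW b_ge2.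
have d0 : (0 < d)%N by case: d_least.
have primes_neq0 : primes b != [::].
  by rewrite primes_eq0 -leqNgt.
have logb_gt0 : {in primes b, forall r, (0 < logn r b)%N}.
  by move=> r; rewrite logn_gt0.
have [q qb qmin] := exists_min_ratio (logn ^~ d) primes_neq0 logb_gt0.
have [p pb pq] : exists2 p, p \in primes b &
    (logn q d * logn p b < logn p d * logn q b)%N.
  apply: exists_ratio_gt => // [p|dvbu].
    exact: least_divisor_prime_dvdn d_least.
  by apply: log_irrational; apply: ln_ratio_rational dvbu => //; exact: logb_gt0.
have logda := least_divisor_logn a0 d_least.
have digits_gt n : (n < b ^ (nonzero_digits b (a ^ n)).+2)%N.
  apply: (@ltn_exp_nonzero_digits _ _ p q) => // [r rb|].
    by rewrite -!logda// qmin.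
  by rewrite -!logda.
have lnb_gt0 : 0 < ln (b%:R : R) by rewrite ln_gt0// ltr1n.
(* With [c] the digit count, [n < b ^ c.+2] gives [ln n < (c + 2) ln b], and [c + 2 <= 3 c] once [c]
   is positive; [n >= b ^ 3] even forces [c >= 2]. *)
exists (3 * ln b%:R)^-1; split; first by rewrite invr_gt0 mulr_gt0.
near=> n; have nb : (b ^ 3 <= n)%N by near: n; exists (b ^ 3)%N.
have n0 : (0 < n)%N by rewrite (leq_trans _ nb)// expn_gt0 b0.
have := digits_gt n; set c := nonzero_digits _ _ => nbc.
have c2 : (2 <= c)%N.
  by have := leq_ltn_trans nb nbc; rewrite ltn_exp2l.
rewrite mulrC ltr_pdivrMr ?mulr_gt0//.
apply: (@lt_le_trans _ _ (ln (b ^ c.+2)%:R)).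
  by rewrite ltr_ln ?ltr_nat// posrE ltr0n// expn_gt0 b0.
rewrite natrX lnXn ?ltr0n// -[leLHS]mulr_natl mulrA ler_pM2r//.
by rewrite -natrM ler_nat; lia.
Unshelve. all: by end_near.
Qed.
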